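(* Suppose the worker distance $\mathrm{dist}$ satisfies the triangle inequality. Then algorithm ApprxGrp (described in the context) is a $2$-approximation algorithm for the problem Grp: on every instance that has a feasible group, ApprxGrp returns a feasible group $\mathcal{G}$ with $$\mathrm{DiaDist}(\mathcal{G})\le 2\cdot\min\{\mathrm{DiaDist}(\mathcal{H}):\ \mathcal{H}\ \text{a feasible group}\}.$$
   Context: **Problem Grp.** An instance consists of a finite worker set $\mathcal{U}=\{u_1,\dots,u_n\}$; skill domains $d_1,\dots,d_m$; skills $u_{d_i}\in[0,1]$ and wages $w_u\in[0,1]$ for every worker $u$; a symmetric distance $\mathrm{dist}(u,v)\in[0,1]$ on workers with $\mathrm{dist}(u,u)=0$; skill thresholds $Q_1,\dots,Q_m\ge0$; and a cost budget $C\ge0$. A nonempty group $\mathcal{G}\subseteq\mathcal{U}$ is feasible if $\sum_{u\in\mathcal{G}}u_{d_i}\ge Q_i$ for all $i$ and $\sum_{u\in\mathcal{G}}w_u\le C$. The goal is to find a feasible group minimizing the diameter $\mathrm{DiaDist}(\mathcal{G})=\max_{u,v\in\mathcal{G}}\mathrm{dist}(u,v)$. **Subroutine GrpCandidateSet($\mathcal{U}'$).** For $\mathcal{U}'\subseteq\mathcal{U}$, it performs a complete branch-and-bound search over the subsets of $\mathcal{U}'$ and stops at the first feasible group found. It returns some feasible group $\mathcal{U}''\subseteq\mathcal{U}'$ if one exists, and $\emptyset$ otherwise. **Subroutine GrpDia($\alpha$).** It goes through the workers $u\in\mathcal{U}$ one at a time. For each $u$ it forms the star centered at $u$ with worker set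 $\mathcal{U}'=\{u\}\cup\{v\in\mathcal{U}:\mathrm{dist}(u,v)\le\alpha\}$ and calls GrpCandidateSet($\mathcal{U}'$). It returns the first nonempty result. If all $n$ workers are exhausted without a nonempty result, it returns $\emptyset$. **Algorithm ApprxGrp.** Let $\mathcal{L}$ be the list, in increasing order, of all distinct distance values $\mathrm{dist}(u,v)$, $u,v\in\mathcal{U}$ (including $0$). The algorithm performs a binary search over $\mathcal{L}$: for each probed value $\alpha$ it calls GrpDia($\alpha$). If the result is nonempty, it stores it together with $\alpha$ and continues with smaller values; if the result is empty, it continues with larger values. At the end it returns the stored group with the smallest associated $\alpha$ (and reports failure if no group was stored). *)

(* Defs.v *)
From mathcomp Require Import all_boot all_order all_algebra.
Set Implicit Arguments.
Unset Strict Implicit.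
Unset Printing Implicit Defensive.
Import Order.TTheory GRing.Theory Num.Theory.
Local Open Scope ring_scope.

Record grp_instance (R : realFieldType) (n m : nat) := GrpInstance {
  skill : 'I_n -> 'I_m -> R;
  wage : 'I_n -> R;
  dist : 'I_n -> 'I_n -> R;
  threshold : 'I_m -> R;
  budget : R;
  skill_itv : forall u i, 0 <= skill u i <= 1;
  wage_itv : forall u, 0 <= wage u <= 1;
  dist_itv : forall u v, 0 <= dist u v <= 1;
  dist_sym : forall u v, dist u v = dist v u;
  dist_refl : forall u, dist u u = 0;
  threshold_ge0 : forall i, 0 <= threshold i;
  budget_ge0 : 0 <= budget
}.

Section Grp.
Variables (R : realFieldType) (n m : nat) (I : grp_instance R n m).

Definition triangle_inequality : Prop :=
  forall u v w, dist I u w <= dist I u v + dist I v w.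

Definition feasible (G : {set 'I_n}) : bool :=
  [&& G != set0,
      [forall i, threshold I i <= \sum_(u in G) skill I u i]
    & \sum_(u in G) wage I u <= budget I].

(* The default 0 is neutral because distances are nonnegative. *)
Definition DiaDist (G : {set 'I_n}) : R :=
  \big[Num.max/0]_(u in G) \big[Num.max/0]_(v in G) dist I u v.

(* The default 1 is neutral because distances are at most 1, so this is the
   minimum as soon as some feasible group exists. *)
Definition opt_dia : R :=
  \big[Num.min/1]_(H : {set 'I_n} | feasible H) DiaDist H.

(* The input/output behaviour of a complete search that stops at the first
   feasible subset found. Which feasible subset that is depends on the
   branching and bounding rules and is left open; [bnb_GrpCandidateSet] below
   exhibits one such search. *)
Definition GrpCandidateSet_spec (cand : {set 'I_n} -> {set 'I_n}) : Prop :=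
  forall W : {set 'I_n},
    ((exists2 G : {set 'I_n}, G \subset W & feasible G) ->
       cand W \subset W /\ feasible (cand W)) /\
    (~ (exists2 G : {set 'I_n}, G \subset W & feasible G) -> cand W = set0).

Definition star (alpha : R) (u : 'I_n) : {set 'I_n} :=
  u |: [set v | dist I u v <= alpha].

Definition dist_values : seq R :=
  sort <=%R (undup [seq dist I u v | u <- enum 'I_n, v <- enum 'I_n]).

Section Algorithm.
Variable cand : {set 'I_n} -> {set 'I_n}.

Definition GrpDia (alpha : R) : {set 'I_n} :=
  head set0 [seq G <- [seq cand (star alpha u) | u <- enum 'I_n] | G != set0].

(* Binary search over the positions lo <= k < hi of the list L, returning the
   pairs (alpha, GrpDia alpha) stored along the way. The interval shrinks at
   every probe, so fuel = hi - lo never interrupts the search. *)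
Fixpoint ApprxGrp_search (L : seq R) (fuel lo hi : nat)
    (stored : seq (R * {set 'I_n})) : seq (R * {set 'I_n}) :=
  if fuel is fuel'.+1 then
    if (lo < hi)%N then
      let mid := (lo + hi)./2 in
      let alpha := L`_mid in
      let G := GrpDia alpha in
      if G != set0
      then ApprxGrp_search L fuel' lo mid ((alpha, G) :: stored)
      else ApprxGrp_search L fuel' mid.+1 hi stored
    else stored
  else stored.

(* None stands for failure. *)
Definition ApprxGrp : option {set 'I_n} :=
  let L := dist_values in
  let stored := ApprxGrp_search L (size L) 0 (size L) [::] in
  omap snd (ohead (sort (fun p q => p.1 <= q.1) stored)).

End Algorithm.

(* A node of the search tree is a set S of chosen workers and the list s of
   undecided ones. It is pruned when S already exceeds the budget, or when all
   undecided workers together cannot reach some skill threshold. *)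
Definition pruned (S : {set 'I_n}) (s : seq 'I_n) : bool :=
  (budget I < \sum_(u in S) wage I u) ||
  [exists i, \sum_(u in S :|: [set x in s]) skill I u i < threshold I i].

Fixpoint bnb (S : {set 'I_n}) (s : seq 'I_n) : {set 'I_n} :=
  if pruned S s then set0
  else if feasible S then S
  else if s is u :: s' then
    let G := bnb (u |: S) s' in if G != set0 then G else bnb S s'
  else set0.

Lemma bnb_sound (S : {set 'I_n}) s :
  bnb S s != set0 -> bnb S s \subset S :|: [set x in s] /\ feasible (bnb S s).
Proof.
elim: s S => [|u s IHs] S /=; case: ifP => _; rewrite ?eqxx //;
  case: ifP => fS; rewrite ?eqxx //.
- by move=> _; rewrite fS subsetUl.
- by move=> _; rewrite fS subsetUl.
have [E|nE] := boolP (bnb (u |: S) s != set0); last first.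
  move=> /IHs [sub ->]; split=> //; apply: subset_trans sub _.
  by apply: setUS; apply/subsetP=> x; rewrite !inE => ->; rewrite orbT.
move=> _; have [sub ->] := IHs _ E; split=> //; apply: subset_trans sub _.
by apply/subsetP=> x; rewrite !inE => /orP[/orP[]|] ->; rewrite ?orbT.
Qed.

Lemma bnb_complete (S : {set 'I_n}) s (H : {set 'I_n}) : feasible H -> S \subset H ->
  H \subset S :|: [set x in s] -> bnb S s != set0.
Proof.
move=> fH; have /and3P[H0 /forallP skH wH] := fH.
have mono (F : 'I_n -> R) (A B : {set 'I_n}) : (forall u, 0 <= F u) ->
    A \subset B -> \sum_(u in A) F u <= \sum_(u in B) F u.
  move=> F0 AB; rewrite (big_setID (A := B) A) /= (setIidPr AB) lerDl.
  by apply: sumr_ge0.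
have np (S' : {set 'I_n}) s' : S' \subset H -> H \subset S' :|: [set x in s'] ->
    pruned S' s' = false.
  move=> SH HS; apply/negbTE; rewrite negb_or -leNgt negb_exists.
  apply/andP; split.
    apply: le_trans wH; apply: mono => // u.
    by case/andP: (wage_itv I u).
  apply/forallP=> i; rewrite -leNgt; apply: le_trans (skH i) _.
  by apply: mono => // u; case/andP: (skill_itv I u i).
elim: s S => [|u s IHs] S SH HS /=; rewrite np //.
  have -> : S = H.
    apply/eqP; rewrite eqEsubset SH; apply: subset_trans HS _.
    by apply/subsetP=> x; rewrite !inE orbF.
  by rewrite fH.
case: ifP => [/and3P[]//|_]; case: ifP => // /negbT; rewrite negbK => E.
have [uH|uH] := boolP (u \in H).
  have /negP[] // : bnb (u |: S) s != set0.
  apply: IHs; first by rewrite subUset sub1set uH.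
  apply: subset_trans HS _; apply/subsetP=> x.
  by rewrite !inE => /or3P[] ->; rewrite ?orbT.
apply: IHs => //; apply/subsetP=> x xH.
move: (subsetP HS x xH); rewrite !inE => /or3P[->//|/eqP xu|->].
  by rewrite -xu xH in uH.
by rewrite orbT.
Qed.

Lemma bnb_GrpCandidateSet :
  GrpCandidateSet_spec (fun W => bnb set0 (enum W)).
Proof.
move=> W; have eW : set0 :|: [set x in enum W] = W.
  by apply/setP=> x; rewrite !inE mem_enum.
split=> [[G GW fG]|nG].
  by rewrite -{2}eW; apply: bnb_sound; apply: (bnb_complete fG);
    rewrite ?sub0set ?eW.
apply/eqP; apply: contra_notT nG => /bnb_sound; rewrite eW => -[sub f].
by exists (bnb set0 (enum W)).
Qed.

End Grp.

(* Main.v *)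
(** If a group [H] has diameter at most [alpha], it lies in the star of radius
    [alpha] around any of its members, so probing [alpha] succeeds. Conversely,
    by the triangle inequality, any group inside a star of radius [alpha] has
    diameter at most [2 * alpha]. The diameter of an optimal group is one of the
    listed distances; every probe at or above it succeeds, so the binary search
    stores some value that does not exceed it. *)
Require Import Defs.
From mathcomp Require Import all_boot all_order all_algebra.
Set Implicit Arguments.
Unset Strict Implicit.
Unset Printing Implicit Defensive.
Import Order.TTheory GRing.Theory Num.Theory.
Local Open Scope ring_scope.

Section ApprxGrpCorrectness.
Variables (R : realFieldType) (n m : nat) (I : grp_instance R n m).
Implicit Types (G H W : {set 'I_n}) (u v : 'I_n) (alpha : R).

Lemma dist_le_DiaDist G u v : u \in G -> v \in G -> dist I u v <= DiaDist I G.
Proof.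
move=> uG vG; rewrite /DiaDist; apply: le_trans (le_bigmax_cond _ _ uG).
exact: le_bigmax_cond.
Qed.

Lemma DiaDist_le G alpha : 0 <= alpha ->
  {in G &, forall u v, dist I u v <= alpha} -> DiaDist I G <= alpha.
Proof.
move=> a0 Ga; apply: bigmax_le => // u uG; apply: bigmax_le => // v vG.
exact: Ga.
Qed.

Lemma DiaDist_ge0 G : 0 <= DiaDist I G.
Proof. exact: bigmax_ge_id. Qed.

Lemma mem_dist_values u v : dist I u v \in dist_values I.
Proof.
by rewrite mem_sort mem_undup; apply: allpairs_f; rewrite mem_enum.
Qed.

Lemma dist_values_sorted : sorted <=%R (dist_values I).
Proof. exact/sort_sorted/le_total. Qed.

(** The list is closed under [Num.max], so only the default [0] of the big maximum needs care: it is
    the distance from some worker to itself, and a member of [G] supplies that worker. *)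
Lemma DiaDist_mem_dist_values G : G != set0 -> DiaDist I G \in dist_values I.
Proof.
case/set0Pn=> w _.
have z : 0 \in dist_values I by rewrite -(dist_refl I w) mem_dist_values.
have mx x y : x \in dist_values I -> y \in dist_values I ->
    Num.max x y \in dist_values I.
  by move=> xL yL; rewrite /Num.max; case: ifP.
apply: (big_ind [in dist_values I]) => // u _.
apply: (big_ind [in dist_values I]) => // v _; exact: mem_dist_values.
Qed.

Lemma opt_dia_attained : (exists H, feasible I H) ->
  exists2 H, feasible I H & DiaDist I H <= opt_dia I.
Proof.
case=> H0 fH0; case: (arg_minP (DiaDist I) fH0) => H fH Hmin.
exists H => //; apply: le_bigmin => //.
(* The default [1] of the minimum also has to be bounded below; distances are at most [1]. *)
by apply: DiaDist_le => // u v _ _; case/andP: (dist_itv I u v).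
Qed.

Lemma star_radius alpha u v : 0 <= alpha -> v \in star I alpha u ->
  dist I u v <= alpha.
Proof. by move=> a0; rewrite !inE => /orP[/eqP->|//]; rewrite dist_refl. Qed.

Lemma sub_star_DiaDist G alpha u : u \in G -> DiaDist I G <= alpha ->
  G \subset star I alpha u.
Proof.
move=> uG Ga; apply/subsetP=> v vG; rewrite !inE (le_trans _ Ga) ?orbT //.
exact: dist_le_DiaDist.
Qed.

Lemma star_mono alpha beta u : alpha <= beta ->
  star I alpha u \subset star I beta u.
Proof.
move=> ab; apply/setUS/subsetP=> v; rewrite !inE => /le_trans; exact.
Qed.

Lemma DiaDist_sub_star G alpha u : triangle_inequality I -> 0 <= alpha ->
  G \subset star I alpha u -> DiaDist I G <= 2 * alpha.
Proof.
move=> tri a0 /subsetP Gu; apply: DiaDist_le => [|v w vG wG].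
  by rewrite mulr_ge0.
apply: le_trans (tri v u w) _; rewrite mulr_natl mulr2n (dist_sym I v u).
by apply: lerD; apply: star_radius => //; apply: Gu.
Qed.

Variable cand : {set 'I_n} -> {set 'I_n}.
Hypothesis candP : GrpCandidateSet_spec I cand.

(** Since there are finitely many subsets, a boolean test decides which clause of the specification
    applies. *)
Lemma cand_sound W : cand W != set0 -> cand W \subset W /\ feasible I (cand W).
Proof.
move=> cW; have [exG nexG] := candP W.
have [/existsP[G /andP[GW fG]]|nG] :=
    boolP [exists G : {set 'I_n}, (G \subset W) && feasible I G].
  by apply: exG; exists G.
case/eqP: cW; apply: nexG => -[G GW fG]; case/existsP: nG.
by exists G; rewrite GW.
Qed.

Lemma GrpDia_sound alpha : GrpDia I cand alpha != set0 ->
  feasible I (GrpDia I cand alpha) /\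
  exists u, GrpDia I cand alpha \subset star I alpha u.
Proof.
rewrite /GrpDia; elim: (enum 'I_n) => [|u s IHs] /=; first by rewrite eqxx.
case: ifP => [c0|_] //= _; have [cW fc] := cand_sound c0.
by split=> //; exists u.
Qed.

(** The star around a member [u] of [H] gives a nonempty result. The scan may stop at an earlier
    star, so only nonemptiness is claimed. *)
Lemma GrpDia_complete H alpha : feasible I H -> DiaDist I H <= alpha ->
  GrpDia I cand alpha != set0.
Proof.
move=> fH Ha; have /and3P[/set0Pn[u uH] _ _] := fH.
have [/(_ (ex_intro2 _ _ H (sub_star_DiaDist uH Ha) fH)) [_ fc] _] :=
  candP (star I alpha u).
have /and3P[c0 _ _] := fc.
have : u \in enum 'I_n by rewrite mem_enum.
rewrite /GrpDia; elim: (enum 'I_n) => //= v s IHs.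
by rewrite inE; case: ifP => //= v0 /predU1P[E|/IHs //]; rewrite -E c0 in v0.
Qed.

Lemma ApprxGrp_search_sound (L : seq R) fuel lo hi stored :
  all (fun p => (p.2 == GrpDia I cand p.1) && (p.2 != set0)) stored ->
  all (fun p => (p.2 == GrpDia I cand p.1) && (p.2 != set0))
    (ApprxGrp_search I cand L fuel lo hi stored).
Proof.
elim: fuel lo hi stored => [|fuel IHf] lo hi stored //= st.
case: ifP => // _; case: ifP => G0; apply: IHf => //=.
by rewrite eqxx G0.
Qed.

(** The invariant is the last premise: position [k] is still in the window, or a value at most that
    at [k] is already stored. Success is assumed only from the value at [k] upwards, so probes below
    it may go either way. *)
Lemma ApprxGrp_search_hit (L : seq R) fuel lo hi stored k :
  sorted <=%R L -> (k < size L)%N -> (hi <= size L)%N -> (hi - lo <= fuel)%N ->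
  (forall alpha, L`_k <= alpha -> GrpDia I cand alpha != set0) ->
  (lo <= k < hi)%N || has (fun p => p.1 <= L`_k) stored ->
  has (fun p => p.1 <= L`_k) (ApprxGrp_search I cand L fuel lo hi stored).
Proof.
move=> Ls kL + + hit.
elim: fuel lo hi stored => [|fuel IHf] lo hi stored hiL /= hf st.
  case/orP: st => // /andP[lok khi].
  (* Without fuel the window is empty and cannot contain [k]. *)
  by move: hf; rewrite leqn0 subn_eq0 leqNgt (leq_ltn_trans lok khi).
case: ltnP => lohi; last first.
  by case/orP: st => // /andP[/leq_ltn_trans/[apply]]; rewrite ltnNge lohi.
set mid := (lo + hi)./2.
have lomid : (lo <= mid)%N by rewrite geq_half_double -addnn leq_add2l ltnW.
have midhi : (mid < hi)%N by rewrite ltn_half_double -addnn ltn_add2r.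
have nth_mono i j : (i <= j)%N -> (j < size L)%N -> L`_i <= L`_j.
  move=> ij jL; apply: (sorted_leq_nth le_trans lexx) => //.
  by rewrite inE (leq_ltn_trans ij).
have midf : (mid - lo <= fuel)%N.
  by rewrite -ltnS; apply: leq_trans hf; rewrite ltn_sub2r.
have [G0|G0] := boolP (_ != set0).
  apply: IHf => //; first exact: leq_trans (ltnW midhi) hiL.
  case/orP: st => [/andP[lok khi]|st] /=; last by rewrite st !orbT.
  (* After a success, either [k] stays in the left half or the value just stored is at most that at
     [k]. *)
  by case: (ltnP k mid) => kmid; rewrite ?lok // nth_mono.
apply: IHf => //.
  by rewrite -ltnS; apply: leq_trans hf; rewrite ltn_sub2l.
case/orP: st => [/andP[lok khi]|->]; last by rewrite orbT.
case: (ltnP mid k) => kmid; first by rewrite khi.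
(* A failed probe cannot lie at or above [k]. *)
by case/negP: G0; apply: hit; rewrite nth_mono // (leq_trans midhi).
Qed.

Lemma ApprxGrp_stored H : feasible I H ->
  exists2 alpha, alpha <= DiaDist I H &
    ApprxGrp I cand = Some (GrpDia I cand alpha) /\
    GrpDia I cand alpha != set0.
Proof.
move=> fH; have /and3P[H0 _ _] := fH.
have HL := DiaDist_mem_dist_values H0.
rewrite /ApprxGrp; set L := dist_values I; set S := ApprxGrp_search _ _ _ _ _ _ _.
have /hasP[q qS qH] : has (fun p => p.1 <= DiaDist I H) S.
  (* The tracked position is the index of the diameter of [H] in [L]. *)
  rewrite -(nth_index 0 HL); apply: ApprxGrp_search_hit => //.
  - exact: dist_values_sorted.
  - by rewrite index_mem.
  - by rewrite subn0.
  - by move=> alpha; rewrite nth_index // => /(GrpDia_complete fH).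
  - by rewrite index_mem HL.
have := @ApprxGrp_search_sound L (size L) 0 (size L) [::] isT; rewrite -/S.
set r := fun p q : R * {set 'I_n} => p.1 <= q.1.
have rt : total r by move=> ? ?; exact: le_total.
have rT : transitive r by move=> ? ? ?; exact: le_trans.
move: (sort_sorted rt S) qS; rewrite -(all_sort _ r) -(mem_sort r).
case: (sort r S) => [|p s] //= ps qs /andP[/andP[/eqP p2 p0] _].
exists p.1; last by rewrite -p2.
(* The returned pair [p] heads the sorted list, so its value is at most that of [q]. *)
apply: le_trans qH; case/predU1P: qs => [->|qs] //.
by have /allP := order_path_min rT ps; apply.
Qed.

End ApprxGrpCorrectness.

Theorem theorem3 (R : realFieldType) (n m : nat) (I : grp_instance R n m)
    (cand : {set 'I_n} -> {set 'I_n})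
    (hcand : GrpCandidateSet_spec I cand)
    (htri : triangle_inequality I)
    (hfeas : exists H : {set 'I_n}, feasible I H) :
  exists G : {set 'I_n},
    [/\ ApprxGrp I cand = Some G,
        feasible I G
      & DiaDist I G <= 2 * opt_dia I].
Proof.
have [H fH Hopt] := opt_dia_attained hfeas.
have [alpha aH [eqG G0]] := ApprxGrp_stored hcand fH.
have [fG [u Gu]] := GrpDia_sound hcand G0.
exists (GrpDia I cand alpha); split=> //.
have aopt := le_trans aH Hopt.
(* The star is widened from [alpha] to the optimum, a radius known to be nonnegative. *)
apply: (DiaDist_sub_star (u := u) htri).
  exact: le_trans (DiaDist_ge0 I H) Hopt.
exact: subset_trans Gu (star_mono I u aopt).
Qed.
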